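(* The common solution set of a countable family of variational inequality problems cannot, in general, be recovered from a finite truncation. In particular, there exist a uniformly smooth and uniformly convex real Banach space $E$ with normalized duality map $J$, a nonempty closed and convex subset $C\subset E$ with $JC$ closed and convex, and a countable family $\{A_j\}_{j=1}^{\infty}$ of continuous monotone mappings from $C$ into $E^{*}$ such that $\bigcap_{j=1}^{\infty}VI(C,A_j)$ is a singleton, while for every finite $N\ge1$ the set $\bigcap_{j=1}^{N}VI(C,A_j)$ is infinite-dimensional.
   Context: $\langle x,x^{*}\rangle$ is the pairing of $x\in E$ with $x^{*}\in E^{*}$. The normalized duality map is $Jx=\{x^{*}\in E^{*}:\langle x,x^{*}\rangle=\|x\|\|x^{*}\|,\ \|x\|=\|x^{*}\|\}$, which is single-valued when $E$ is uniformly smooth. For $A:C\to E^{*}$, $VI(C,A)=\{x\in C:\langle y-x,Ax\rangle\ge0\ \forall y\in C\}$. $A$ is monotone if $\langle x-y,Ax-Ay\rangle\ge0$ for all $x,y\in C$. A set is infinite-dimensional if it is not contained in any finite-dimensional affine subspace. *)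

(* Defs.v *)
From HB Require Import structures.
From mathcomp Require Import all_boot all_order all_algebra.
From mathcomp Require Import all_classical all_reals all_analysis.

Set Implicit Arguments.
Unset Strict Implicit.
Unset Printing Implicit Defensive.

Import Order.TTheory GRing.Theory Num.Theory.
Import numFieldNormedType.Exports.

Local Open Scope classical_set_scope.
Local Open Scope ring_scope.

Section Dual.
Context {R : realType} (E : normedModType R).

Definition dual_pred : {pred E -> R^o} :=
  mem [set f : E -> R^o | linear f /\ continuous f].

Lemma dual_predP (f : E -> R^o) :
  reflect (linear f /\ continuous f) (f \in dual_pred).
Proof. by apply: (iffP idP); rewrite inE. Qed.

Lemma dual_submod_closed : submod_closed dual_pred.
Proof.
split.
  apply/dual_predP; split; last by move=> x; exact: cvg_cst.
  by move=> a x y /=; rewrite scaler0 addr0.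
move=> a f g /dual_predP[lf cf] /dual_predP[lg cg]; apply/dual_predP; split.
  move=> b x y; rewrite /= !fctE lf lg !scalerDr !scalerA (mulrC a b).
  by rewrite addrACA.
move=> x; apply: cvgD; last exact: cg.
by apply: cvgZr; exact: cf.
Qed.

HB.instance Definition _ :=
  GRing.isSubmodClosed.Build _ _ dual_pred dual_submod_closed.

(* The topological dual E^*; the pairing <x, f> is the application f x. *)
Record dual : Type := Dual {
  dual_fun :> E -> R^o;
  dual_funP : dual_fun \in dual_pred }.

HB.instance Definition _ := [isSub for dual_fun].
HB.instance Definition _ := [Choice of dual by <:].
HB.instance Definition _ := [SubChoice_isSubLmodule of dual by <:].

Definition dual_norm (f : dual) : R := sup [set `|f x| | x in [set x | `|x| <= 1]].

Lemma dual_linear (f : dual) : linear f.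
Proof. by have /dual_predP[] := dual_funP f. Qed.

Lemma dual_continuous (f : dual) : continuous f.
Proof. by have /dual_predP[] := dual_funP f. Qed.

HB.instance Definition _ (f : dual) :=
  GRing.isLinear.Build R E R^o *:%R (dual_fun f) (@dual_linear f).

Lemma dual_addE (f g : dual) (x : E) : (f + g) x = f x + g x.
Proof. by []. Qed.

Lemma dual_oppE (f : dual) (x : E) : (- f) x = - f x.
Proof. by []. Qed.

Lemma dual_scaleE (a : R) (f : dual) (x : E) : (a *: f) x = a * f x.
Proof. by []. Qed.

Lemma dual_norm_has_sup (f : dual) :
  has_sup [set `|f x| | x in [set x | `|x| <= 1]].
Proof.
split; first by exists `|f 0|, 0 => //=; rewrite normr0.
have /bounded_funP/(_ 1)[M fM] :
    bounded_near (dual_fun f) (nbhs (0 : E)).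
  exact/linear_bounded_continuous/dual_continuous.
by exists M => _ [x /= x1 <-]; exact: fM.
Qed.

Lemma dual_norm_ub (f : dual) (x : E) : `|x| <= 1 -> `|f x| <= dual_norm f.
Proof.
by move=> x1; apply: sup_upper_bound; [exact: dual_norm_has_sup|exists x].
Qed.

Lemma dual_norm_le (f : dual) (M : R) :
  (forall x : E, `|x| <= 1 -> `|f x| <= M) -> dual_norm f <= M.
Proof.
move=> fM; apply: ge_sup; first by have [] := dual_norm_has_sup f.
by move=> _ [x /= x1 <-]; exact: fM.
Qed.

Lemma ler_dual_normD (f g : dual) :
  dual_norm (f + g) <= dual_norm f + dual_norm g.
Proof.
apply: dual_norm_le => x x1; rewrite dual_addE (le_trans (ler_normD _ _))//.
by rewrite lerD// dual_norm_ub.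
Qed.

Lemma dual_norm_ge0 (f : dual) : 0 <= dual_norm f.
Proof. by rewrite (le_trans (normr_ge0 (f 0)))// dual_norm_ub// normr0. Qed.

Lemma dual_norm_eq0 (f : dual) : dual_norm f = 0 -> f = 0.
Proof.
move=> f0; apply/val_inj/funext => x /=.
have [->|x0] := eqVneq x 0; first exact: linear0.
apply/eqP; rewrite -normr_le0.
have : `|f (`|x|^-1 *: x)| <= 0.
  by rewrite -f0 dual_norm_ub// normrZ normfV normr_id mulVf ?normr_eq0.
by rewrite linearZ/= normrZ normfV normr_id pmulr_rle0// invr_gt0 normr_gt0.
Qed.

Lemma dual_normZ (a : R) (f : dual) : dual_norm (a *: f) = `|a| * dual_norm f.
Proof.
have le b g : dual_norm (b *: g) <= `|b| * dual_norm g.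
  apply: dual_norm_le => x x1; rewrite dual_scaleE normrM.
  by rewrite ler_wpM2l// dual_norm_ub.
have [->|a0] := eqVneq a 0.
  by apply/eqP; rewrite eq_le le normr0 mul0r dual_norm_ge0.
apply/eqP; rewrite eq_le le /= -ler_pdivlMl ?normr_gt0// -normfV.
by rewrite (le_trans _ (le _ _))// scalerA mulVf// scale1r.
Qed.

HB.instance Definition _ :=
  Lmodule_isNormed.Build R dual ler_dual_normD dual_normZ dual_norm_eq0.

Lemma dual_normE (f : dual) :
  `|f| = sup [set `|f x| | x in [set x | `|x| <= 1]].
Proof. by []. Qed.

End Dual.

Section Geometry.
Context {R : realType} (E : normedModType R).

Definition uniformly_convex : Prop :=
  forall e : R, 0 < e -> e <= 2 ->
  exists2 d : R, 0 < d &
    forall x y : E, `|x| = 1 -> `|y| = 1 -> e <= `|x - y| ->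
      `|2^-1 *: (x + y)| <= 1 - d.

Definition smoothness_modulus (t : R) : R :=
  sup [set r | exists x y : E,
    [/\ `|x| = 1, `|y| = t & r = (`|x + y| + `|x - y|) / 2 - 1]].

Definition uniformly_smooth : Prop :=
  smoothness_modulus t / t @[t --> 0^'+] --> (0 : R).

(* The normalized duality map as a set-valued map. *)
Definition duality_map (x : E) : set (dual E) :=
  [set f : dual E | f x = `|x| * `|f| /\ `|x| = `|f|].

Definition duality_image (C : set E) : set (dual E) :=
  \bigcup_(x in C) duality_map x.

Definition monotone_on (C : set E) (A : E -> dual E) : Prop :=
  forall x y, C x -> C y -> 0 <= (A x - A y) (x - y).

Definition VI (C : set E) (A : E -> dual E) : set E :=
  [set x | C x /\ forall y, C y -> 0 <= A x (y - x)].

Definition affine_subspace_of (n : nat) (p : E) (v : 'I_n -> E) : set E :=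
  [set p + \sum_(i < n) c i *: v i | c in [set: 'I_n -> R]].

Definition infinite_dimensional (S : set E) : Prop :=
  ~ exists (n : nat) (p : E) (v : 'I_n -> E), S `<=` affine_subspace_of p v.

End Geometry.

(* Main.v *)
(** Take for [E] the real Hilbert space l2, for [C] the whole space, and
    [A_j x = <x, e_j> e_j], read as a functional through the Riesz map, where
    [e_j] is the standard orthonormal sequence. Each [A_j] is linear and
    monotone, and [VI E A_j] is the hyperplane [{x | <x, e_j> = 0}]: all these
    hyperplanes meet only at [0], while the first [N] of them contain the
    independent vectors [e_N, e_(N+1), ...]. The parallelogram law gives
    uniform convexity and smoothness. On a Hilbert space [J] is the isometric
    Riesz map, so completeness alone makes its range closed. *)
Require Import Defs.
From HB Require Import structures.
From mathcomp Require Import all_boot all_order all_algebra.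
From mathcomp Require Import all_classical all_reals all_analysis.
From mathcomp Require Import ring lra.

Set Implicit Arguments.
Unset Strict Implicit.
Unset Printing Implicit Defensive.

Import Order.TTheory GRing.Theory Num.Theory.
Import numFieldNormedType.Exports.
Local Open Scope classical_set_scope.
Local Open Scope ring_scope.

(** * Inner products on a real vector space and the Cauchy-Schwarz inequality *)

Record inner_product {R : realType} {E : lmodType R} (ip : E -> E -> R) : Prop :=
  InnerProduct {
    ip_sym : forall x y, ip x y = ip y x;
    ip_addl : forall x y z, ip (x + y) z = ip x z + ip y z;
    ip_scalel : forall a x y, ip (a *: x) y = a * ip x y;
    ip_ge0 : forall x, 0 <= ip x x }.

Section InnerProductTheory.
Context {R : realType} {E : lmodType R} {ip : E -> E -> R}.
Hypothesis ipP : inner_product ip.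

Lemma ip_addr x y z : ip x (y + z) = ip x y + ip x z.
Proof. by rewrite (ip_sym ipP) (ip_addl ipP) !(ip_sym ipP x). Qed.

Lemma ip_scaler a x y : ip x (a *: y) = a * ip x y.
Proof. by rewrite (ip_sym ipP) (ip_scalel ipP) (ip_sym ipP y). Qed.

Lemma ip_oppl x y : ip (- x) y = - ip x y.
Proof. by rewrite -[- x]scaleN1r (ip_scalel ipP) mulN1r. Qed.

Lemma ip_oppr x y : ip x (- y) = - ip x y.
Proof. by rewrite -[- y]scaleN1r ip_scaler mulN1r. Qed.

Lemma ip0l x : ip 0 x = 0.
Proof. by rewrite -(scale0r 0) (ip_scalel ipP) mul0r. Qed.

Lemma ip_suml n (f : 'I_n -> E) y : ip (\sum_i f i) y = \sum_i ip (f i) y.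
Proof.
apply: (big_morph (ip^~ y)) => [a b|]; [exact: ip_addl|exact: ip0l].
Qed.

Lemma ip_CauchySchwarz x y : ip x y ^+ 2 <= ip x x * ip y y.
Proof.
have ge0 a b : 0 <= a ^+ 2 * ip x x - 2 * a * b * ip x y + b ^+ 2 * ip y y.
  have := ip_ge0 ipP (a *: x - b *: y).
  rewrite !(ip_addl ipP, ip_addr, ip_oppl, ip_oppr, ip_scalel ipP, ip_scaler).
  by rewrite (ip_sym ipP y x); nra.
have := ip_ge0 ipP y; rewrite le_eqVlt => /predU1P[y0|y0].
  (* The form may be degenerate, so [ip y y = 0] does not give [y = 0]. With these coefficients
     [ge0] reads [0 <= - (ip x y)^2 (ip x x + 2)], which forces [ip x y = 0]. *)
  have := ge0 (ip x y) (ip x x + 1); have := ip_ge0 ipP x; rewrite -y0.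
  by nra.
(* These coefficients minimise the form along [y] and leave [ip y y] times the Cauchy-Schwarz
   gap. *)
have := ge0 (ip y y) (ip x y); rewrite -[X in 0 <= X](_ :
    ip y y * (ip x x * ip y y - ip x y ^+ 2) = _); last by ring.
by rewrite pmulr_rge0// subr_ge0.
Qed.

Lemma ip_CauchySchwarz_sqrt x y :
  `|ip x y| <= Num.sqrt (ip x x) * Num.sqrt (ip y y).
Proof.
rewrite -sqrtrM ?ip_ge0// -sqrtr_sqr ler_wsqrtr//.
exact: ip_CauchySchwarz.
Qed.

(** Works over a bare [lmodType], because the norm of [l2] is itself built from this inequality and
    from [sqrt_ipZ]. *)
Lemma sqrt_ip_triangle x y : Num.sqrt (ip (x + y) (x + y)) <=
  Num.sqrt (ip x x) + Num.sqrt (ip y y).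
Proof.
rewrite -[leRHS]ger0_norm ?addr_ge0 ?sqrtr_ge0// -sqrtr_sqr ler_wsqrtr//.
rewrite sqrrD !sqr_sqrtr ?ip_ge0// !(ip_addl ipP, ip_addr) (ip_sym ipP y x).
have := ler_norm (ip x y); have := ip_CauchySchwarz_sqrt x y; lra.
Qed.

Lemma sqrt_ipZ a x :
  Num.sqrt (ip (a *: x) (a *: x)) = `|a| * Num.sqrt (ip x x).
Proof.
by rewrite (ip_scalel ipP) ip_scaler mulrA -expr2 sqrtrM ?sqr_ge0// sqrtr_sqr.
Qed.

End InnerProductTheory.

(** * Uniform convexity and smoothness of an inner product norm *)

Section InnerProductSpace.
Context {R : realType} {E : normedModType R} {ip : E -> E -> R}.
Hypotheses (ipP : inner_product ip) (normE : forall x, `|x| ^+ 2 = ip x x).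

Lemma ip_le_norm (x y : E) : `|ip x y| <= `|x| * `|y|.
Proof.
have := ip_CauchySchwarz_sqrt ipP x y.
by rewrite -!normE !sqrtr_sqr !normr_id.
Qed.

Lemma parallelogram (x y : E) :
  `|x + y| ^+ 2 + `|x - y| ^+ 2 = 2 * (`|x| ^+ 2 + `|y| ^+ 2).
Proof.
rewrite !normE !(ip_addl ipP, ip_addr ipP, ip_oppl ipP, ip_oppr ipP).
by ring.
Qed.

Lemma ip_uniformly_convex : uniformly_convex E.
Proof.
(* By the parallelogram law the midpoint has norm at most [sqrt (1 - e^2/4)], and this is at most
   [1 - e^2/8]. *)
move=> e e0 e2; exists (e ^+ 2 / 8); first by rewrite divr_gt0// exprn_gt0.
move=> x y x1 y1 exy; have := parallelogram x y; rewrite x1 y1.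
have : e ^+ 2 <= `|x - y| ^+ 2 by rewrite ler_sqr ?nnegrE ?(ltW e0).
move=> h1 h2; have e4 : e ^+ 2 <= 4 by nra.
rewrite normrZ ger0_norm// ler_pdivrMl//.
have n0 := normr_ge0 (x + y); rewrite leNgt; apply/negP => c; nra.
Qed.

(** With [a = |x + y|] and [b = |x - y|], the parallelogram law gives [(a + b)^2 <= 4 (1 + t^2)],
    and [sqrt (1 + t^2) <= 1 + t^2/2]. The lower bound is the triangle inequality for
    [2x = (x + y) + (x - y)]. *)
Lemma smoothness_modulus_bound t : 0 < t ->
  0 <= smoothness_modulus E t <= t ^+ 2 / 2.
Proof.
move=> t0; rewrite /smoothness_modulus; set S := [set r | _].
have SB r : S r -> 0 <= r <= t ^+ 2 / 2.
  move=> [x [y [x1 yt ->]]]; have := parallelogram x y; rewrite x1 yt => p.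
  have : `|x + x| <= `|x + y| + `|x - y|.
    by rewrite (le_trans _ (ler_normD _ _))// addrACA subrr addr0.
  rewrite -mulr2n normrMn x1 => h; apply/andP; split; first by lra.
  have := sqr_ge0 (`|x + y| - `|x - y|).
  have := normr_ge0 (x + y); have := normr_ge0 (x - y).
  move: (`|x + y|) (`|x - y|) p h => a b p h b0 a0 d.
  have s2 : (a + b) ^+ 2 <= 4 * (1 + t ^+ 2) by nra.
  rewrite leNgt; apply/negP => c; nra.
(* In the zero space [S] is empty and its [sup] is 0 by convention. *)
have [S0|/set0P[r Sr]] := eqVneq S set0.
  by rewrite S0 sup0 lexx divr_ge0// sqr_ge0.
have ubS : has_sup S.
  by split; [exists r|exists (t ^+ 2 / 2) => s /SB/andP[]].
apply/andP; split.
  by have /andP[+ _] := SB _ Sr; move=> /le_trans; apply; exact: sup_upper_bound.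
by apply: ge_sup; [exists r|move=> s /SB/andP[]].
Qed.

Lemma ip_uniformly_smooth : uniformly_smooth E.
Proof.
apply: (@squeeze_cvgr _ _ _ _ (cst 0) (fun t => t / 2)).
- near=> t; have t0 : 0 < t by near: t; exact: nbhs_right_gt.
  have /andP[m0 mt] := smoothness_modulus_bound t0.
  by rewrite /= divr_ge0 ?(ltW t0)//= ler_pdivrMr// mulrAC -expr2.
- exact: cvg_cst.
- rewrite -[X in _ --> X](mul0r 2^-1).
  by apply: cvg_at_right_filter; apply: cvgMl; exact: cvg_id.
Unshelve. all: by end_near. Qed.

(** * The Riesz map and the duality map *)

Definition riesz_fun (x : E) : E -> R^o := ip x.

Lemma riesz_fun_linear x : linear (riesz_fun x).
Proof.
by move=> a y z; rewrite /riesz_fun (ip_addr ipP) (ip_scaler ipP).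
Qed.

Lemma riesz_fun_continuous x : continuous (riesz_fun x).
Proof.
move=> y; apply/cvgrPdist_le => e e0; near=> z.
rewrite /riesz_fun -(ip_oppr ipP) -(ip_addr ipP).
rewrite (le_trans (ip_le_norm _ _))//.
have xp : 0 < `|x| + 1 by rewrite ltr_wpDl.
rewrite (@le_trans _ _ ((`|x| + 1) * `|y - z|)) ?ler_wpM2r ?lerDl//.
rewrite mulrC -ler_pdivlMr//.
near: z; apply: cvgr_dist_le; first exact: cvg_id.
by rewrite divr_gt0.
Unshelve. all: by end_near. Qed.

Lemma riesz_funP x : riesz_fun x \in @dual_pred R E.
Proof.
by apply/dual_predP; split; [exact: riesz_fun_linear|exact: riesz_fun_continuous].
Qed.

Definition riesz (x : E) : dual E := Dual (riesz_funP x).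

Lemma riesz_linear : linear riesz.
Proof.
move=> a x y; apply/val_inj/funext => z.
by rewrite /= /riesz_fun (ip_addl ipP) (ip_scalel ipP).
Qed.

HB.instance Definition _ :=
  GRing.isLinear.Build R E (dual E) *:%R riesz riesz_linear.

Lemma norm_riesz x : `|riesz x| = `|x|.
Proof.
rewrite dual_normE -/(dual_norm _).
apply/eqP; rewrite eq_le; apply/andP; split.
  apply: dual_norm_le => y y1; rewrite (le_trans (ip_le_norm _ _))//.
  by rewrite ler_piMr.
have [->|x0] := eqVneq x 0; first by rewrite normr0 dual_norm_ge0.
have nx : `|x| != 0 by rewrite normr_eq0.
(* The supremum defining the dual norm is attained at the normalised vector [x / |x|]. *)
have -> : `|x| = `|riesz x (`|x|^-1 *: x)|.
  rewrite linearZ/= /riesz_fun -normE normrM normrX !normfV !normr_id.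
  by rewrite expr2 mulKf.
by apply: dual_norm_ub; rewrite normrZ normfV normr_id mulVf.
Qed.

(* AM-GM turns [f (x + t y) <= |x| |x + t y|] into a quadratic inequality in
   [t] whose linear coefficient [f y - ip x y] must therefore vanish. *)
Lemma duality_mapE x : duality_map x = [set riesz x].
Proof.
apply/seteqP; split => [f [fx nf]|_ ->]; last first.
  by rewrite /duality_map /= norm_riesz /riesz_fun -normE expr2.
apply/val_inj/funext => y; rewrite /= /riesz_fun.
have dual_le z : f z <= `|x| * `|z|.
  rewrite nf; have [->|z0] := eqVneq z 0; first by rewrite linear0 normr0 mulr0.
  have nz : 0 < `|z| by rewrite normr_gt0.
  rewrite -ler_pdivrMr// mulrC.
  have -> : `|z|^-1 * f z = f (`|z|^-1 *: z) by rewrite linearZ.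
  apply: le_trans (ler_norm _) _; apply: dual_norm_ub.
  by rewrite normrZ normfV normr_id mulVf// gt_eqF.
have quad t : t * (f y - ip x y) <= t ^+ 2 * `|y| ^+ 2 / 2.
  have := dual_le (x + t *: y); rewrite linearD linearZ/= fx -nf.
  rewrite -[t *: f y]/(t * f y).
  have : `|x + t *: y| ^+ 2 = `|x| ^+ 2 + 2 * t * ip x y + t ^+ 2 * `|y| ^+ 2.
    rewrite !normE !(ip_addl ipP, ip_addr ipP, ip_scalel ipP, ip_scaler ipP).
    by rewrite (ip_sym ipP y x); ring.
  have := sqr_ge0 (`|x| - `|x + t *: y|).
  move: (`|x + _|) => n; nra.
move: quad; set d := f y - _; set k := `|y| ^+ 2 => quad.
have k0 : 0 <= k by exact: sqr_ge0.
have kp : 0 < k + 1 by lra.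
suff : d = 0 by move/eqP; rewrite subr_eq0 => /eqP.
(* Dividing by [k + 1] rather than [k] covers [y = 0]. For [q = d / (k + 1)] the inequality becomes
   [q^2 (k + 1) <= q^2 k / 2], hence [q = 0]. *)
have := quad (d / (k + 1)).
have -> : d / (k + 1) * d = (d / (k + 1)) ^+ 2 * (k + 1).
  by field; rewrite gt_eqF.
set q := d / (k + 1) => h; have : q = 0 by nra.
by move/eqP; rewrite mulf_eq0 invr_eq0 (gt_eqF kp) orbF => /eqP.
Qed.

Lemma duality_imageE : duality_image [set: E] = range riesz.
Proof.
apply/seteqP; split => f.
  by move=> [x _]; rewrite duality_mapE => ->; exists x.
by move=> [x _ <-]; exists x => //; rewrite duality_mapE.
Qed.

Lemma convex_range_riesz :
  convex_set (range riesz : set (convex_lmodType (dual E))).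
Proof.
move=> f g l; rewrite !inE => -[x _ <-] [y _ <-].
exists (l%:num *: x + (1 - l%:num) *: y) => //.
by rewrite linearD !linearZ.
Qed.

(** * Rank-one monotone maps and their solution hyperplanes *)

Definition coordinate_map (e x : E) : dual E := ip x e *: riesz e.

Lemma coordinate_mapE e x y : coordinate_map e x y = ip x e * ip y e.
Proof. by rewrite [ip y e](ip_sym ipP). Qed.

Lemma coordinate_map_continuous e : continuous (coordinate_map e).
Proof.
move=> x; apply: cvgZr_tmp.
have -> : ip^~ e = dual_fun (riesz e).
  by apply/funext => y; rewrite (ip_sym ipP).
by rewrite (ip_sym ipP); exact: (@dual_continuous _ _ (riesz e) x).
Qed.

Lemma coordinate_map_monotone e (C : set E) : monotone_on C (coordinate_map e).
Proof.
move=> x y _ _; rewrite dual_addE dual_oppE !coordinate_mapE -mulrBl.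
by rewrite (ip_addl ipP) (ip_oppl ipP) -expr2 sqr_ge0.
Qed.

Lemma VI_coordinate_map e :
  VI setT (coordinate_map e) = [set x | ip x e = 0].
Proof.
apply/seteqP; split => x /=.
  (* Testing against the point 0 yields [- (ip x e)^2 >= 0]. *)
  move=> [_ /(_ 0 I)]; rewrite coordinate_mapE sub0r (ip_oppl ipP) mulrN.
  rewrite oppr_ge0 -expr2 => le0; apply/eqP.
  by rewrite -sqrf_eq0 eq_le le0 sqr_ge0.
by move=> xe; split => // y _; rewrite coordinate_mapE xe mul0r.
Qed.

(** * Orthonormal sequences and infinite dimension *)

Section OrthonormalSequence.
Variable e : nat -> E.
Hypothesis e_orthonormal : forall i j, ip (e i) (e j) = (i == j)%:R.

(** If [n] directions sufficed, the [n + 1] vectors [e N], ..., [e (N + n)] would lie in a span of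
    [n] vectors and be linearly dependent, contradicting orthonormality. *)
Lemma orthonormal_infinite_dimensional (N : nat) :
  infinite_dimensional [set x | forall j, (j < N)%N -> ip x (e j) = 0].
Proof.
move=> [n [p [v Sv]]].
have /(_ _)/cid-/all_sig[c cP] (k : 'I_n.+1) : exists c : 'I_n -> R,
    e (N + k)%N = \sum_i c i *: v i.
  have [|c _ ce] := Sv (e (N + k)%N).
    move=> j jN; rewrite e_orthonormal; case: eqP => // jk.
    by move: jN; rewrite -jk ltnNge leq_addr.
  (* Since 0 lies in the set, [- p] is a combination of the [v i]; subtracting the coefficients of 0
     makes the affine representation linear. *)
  have [|c0 _ c00] := Sv 0; first by move=> j _; rewrite (ip0l ipP).
  exists (fun i => c i - c0 i).
  under eq_bigr do rewrite scalerBl.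
  have c0E : \sum_i c0 i *: v i = - p.
    by apply/eqP; rewrite -addr_eq0 addrC; apply/eqP.
  by rewrite sumrB c0E opprK addrC ce.
pose M := \matrix_(k < n.+1, i < n) c k i.
(* [M] has [n + 1] rows and rank at most [n], so its rows satisfy a nontrivial relation [w]. *)
have : kermx M != 0.
  by rewrite kermx_eq0 /row_free neq_ltn ltnS rank_leq_col.
case/rowV0Pn => w /sub_kermxP wM /negP; apply; apply/eqP/rowP => k.
rewrite mxE.
have w0 : \sum_k w 0 k *: e (N + k)%N = 0.
  under eq_bigr do rewrite cP scaler_sumr.
  rewrite exchange_big /= big1// => i _.
  under eq_bigr do rewrite scalerA.
  rewrite -scaler_suml; have /rowP/(_ i) := wM; rewrite !mxE.
  by under eq_bigr do rewrite mxE; move=> ->; rewrite scale0r.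
(* Pairing the relation with [e (N + k)] isolates the coefficient [w 0 k], which must vanish. *)
have := ip0l ipP (e (N + k)%N); rewrite -w0 (ip_suml ipP).
rewrite (bigD1 k)//= big1 ?addr0; last first.
  move=> i ik; rewrite (ip_scalel ipP) e_orthonormal eqn_add2l.
  by rewrite (negbTE (ik : (i != k :> nat))) mulr0.
by rewrite (ip_scalel ipP) e_orthonormal eqxx mulr1.
Qed.

End OrthonormalSequence.

End InnerProductSpace.

(** * Closed range of a linear isometry on a complete space *)

Lemma closed_range_isometry {R : realType} (E : completeNormedModType R)
    (F : normedModType R) (f : {linear E -> F}) :
  (forall x, `|f x| = `|x|) -> closed (range f).
Proof.
move=> fN g gcl.
have near_g d : 0 < d -> exists x, `|f x - g| < d.
  move=> d0; have [_ [[x _ <-] gx]] := gcl _ (nbhsx_ballx g d d0).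
  by exists x; rewrite distrC; rewrite -ball_normE in gx.
(* The preimages of the balls around the limit point [g] generate a proper filter, Cauchy because
   [f] preserves distances. Its limit [x] satisfies [f x = g]. *)
pose B (d : R) := [set x | `|f x - g| < d].
pose G := filter_from [set d : R | 0 < d] B.
have GF : ProperFilter G.
  apply: filter_from_proper; last by move=> d /near_g.
  apply: filter_from_filter; first by exists 1 => /=.
  move=> i j /= i0 j0; exists (Num.min i j) => /=; first by rewrite lt_min i0.
  by move=> x; rewrite /B /= lt_min => /andP[].
have : cvg G.
  apply: cauchy_cvg; apply: cauchy_exP => d d0.
  have [x fxg] := near_g _ (divr_gt0 d0 (ltr0n R 2)).
  exists x; exists (d / 2) => /=; first exact: divr_gt0.
  move=> y fyg; rewrite -ball_normE /= -fN linearB.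
  rewrite [ltRHS]splitr -(subrKA g) (le_lt_trans (ler_normD _ _))//.
  by rewrite ltrD// distrC.
move/cvg_ex => [x Gx]; exists x => //.
apply/eqP; rewrite -subr_eq0 -normr_le0; apply/ler_addgt0Pr => d d0.
rewrite add0r.
have [y [/= xy fyg]] : ((ball x (d / 2)) `&` B (d / 2)) !=set0.
  apply: (@filter_ex _ G); apply: filterI; last first.
    by exists (d / 2) => //=; exact: divr_gt0.
  by apply: Gx; apply: nbhsx_ballx; exact: divr_gt0.
rewrite -(subrKA (f y)) (le_trans (ler_normD _ _))// [leRHS]splitr lerD// ltW//.
by rewrite -linearB fN; rewrite -ball_normE in xy.
Qed.

(** * The Hilbert space of square-summable sequences *)

Section L2.
Context {R : realType}.
Implicit Types u v : nat -> R^o.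

Definition l2_pred : {pred nat -> R^o} :=
  mem [set u | cvgn (series (fun i => u i ^+ 2 : R^o))].

Lemma l2_predP u :
  reflect (cvgn (series (fun i => u i ^+ 2 : R^o))) (u \in l2_pred).
Proof. by apply: (iffP idP); rewrite inE. Qed.

(** Comparison with [u^2 + v^2], which dominates [|u v|]. This gives closure of [l2_pred] under sums
    and makes the [limn] in [l2_ip] a genuine limit rather than a default value. *)
Lemma l2_cvg_mul u v : u \in l2_pred -> v \in l2_pred ->
  cvgn (series (fun i => u i * v i : R^o)).
Proof.
move=> /l2_predP u2 /l2_predP v2; apply: normed_cvg.
apply: (@series_le_cvg R _ (fun i => u i ^+ 2 + v i ^+ 2)) => [n|n|n|] /=.
- exact: normr_ge0.
- by rewrite addr_ge0 ?sqr_ge0.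
- rewrite normrM -(real_normK (num_real (u n))) -(real_normK (num_real (v n))).
  have := mulr_ge0 (normr_ge0 (u n)) (normr_ge0 (v n)).
  by have := sqr_ge0 (`|u n| - `|v n|); nra.
- exact: is_cvg_seriesD.
Qed.

Lemma l2_submod_closed : submod_closed l2_pred.
Proof.
split.
  apply/l2_predP; rewrite (_ : series _ = cst 0); first exact: is_cvg_cst.
  by apply/funext => n; rewrite /series /= big1// => i _; rewrite expr0n.
move=> a u v ul vl; apply/l2_predP.
rewrite (_ : (fun i => _) = (a ^+ 2 *: (fun i => u i * u i : R^o)) +
  ((2 * a) *: (fun i => u i * v i : R^o)) + (fun i => v i * v i : R^o)).
  apply: is_cvg_seriesD; last exact: l2_cvg_mul.
  by apply: is_cvg_seriesD; apply: is_cvg_seriesZ; exact: l2_cvg_mul.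
by apply/funext => i; rewrite !fctE /GRing.scale /=; ring.
Qed.

HB.instance Definition _ :=
  GRing.isSubmodClosed.Build _ _ l2_pred l2_submod_closed.

Record l2 : Type := L2 { l2_fun :> nat -> R^o; l2_funP : l2_fun \in l2_pred }.

HB.instance Definition _ := [isSub for l2_fun].
HB.instance Definition _ := [Choice of l2 by <:].
HB.instance Definition _ := [SubChoice_isSubLmodule of l2 by <:].

Definition l2_ip (x y : l2) : R := limn (series (fun i => x i * y i : R^o)).

Lemma l2_ip_is_inner_product : inner_product l2_ip.
Proof.
have cxy (x y : l2) := l2_cvg_mul (l2_funP x) (l2_funP y).
split.
- move=> x y; rewrite /l2_ip; congr (limn (series _)).
  by apply/funext => i; rewrite mulrC.
- move=> x y z; rewrite /l2_ip -(lim_seriesD (cxy x z) (cxy y z)).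
  congr (limn (series _)); by apply/funext => i; rewrite fctE mulrDl.
- move=> a x y; rewrite /l2_ip -[RHS](lim_seriesZ a (cxy x y)).
  congr (limn (series _)); apply/funext => i; rewrite fctE /= /GRing.scale /=.
  by rewrite mulrA.
- move=> x; rewrite /l2_ip; apply: limr_ge; first exact: cxy.
  by apply: nearW => n; rewrite sumr_ge0// => i _; rewrite -expr2 sqr_ge0.
Qed.

Lemma l2_sum_sqr_le (x : l2) n : \sum_(0 <= i < n) x i ^+ 2 <= l2_ip x x.
Proof.
apply: (nondecreasing_cvgn_le _ (l2_cvg_mul (l2_funP x) (l2_funP x)) n).
by apply: nondecreasing_series => i _ _; rewrite -expr2 sqr_ge0.
Qed.

(** With [l2_sum_sqr_le], this identifies [l2_ip x x] as the least upper bound of the finite sums,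
    so norm estimates reduce to finitely many coordinates. *)
Lemma l2_ip_le (x : l2) (M : R) :
  (forall n, \sum_(0 <= i < n) x i ^+ 2 <= M) -> l2_ip x x <= M.
Proof.
move=> xM; apply: limr_le; first exact: l2_cvg_mul (l2_funP x) (l2_funP x).
by apply: nearW.
Qed.

Lemma l2_coord_sqr_le (x : l2) i : x i ^+ 2 <= l2_ip x x.
Proof.
apply: le_trans (l2_sum_sqr_le x i.+1).
by rewrite big_nat_recr//= lerDr sumr_ge0// => j _; rewrite sqr_ge0.
Qed.

Lemma l2_ip_eq0 (x : l2) : l2_ip x x = 0 -> x = 0.
Proof.
move=> x0; apply/val_inj/funext => i /=; apply/eqP.
by rewrite -sqrf_eq0 eq_le sqr_ge0 -x0 l2_coord_sqr_le.
Qed.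

Definition l2_norm (x : l2) : R := Num.sqrt (l2_ip x x).

Lemma ler_l2_normD x y : l2_norm (x + y) <= l2_norm x + l2_norm y.
Proof. exact/sqrt_ip_triangle/l2_ip_is_inner_product. Qed.

Lemma l2_normZ a x : l2_norm (a *: x) = `|a| * l2_norm x.
Proof. exact/sqrt_ipZ/l2_ip_is_inner_product. Qed.

Lemma l2_norm_eq0 x : l2_norm x = 0 -> x = 0.
Proof.
move=> /eqP; rewrite sqrtr_eq0 => x0; apply: l2_ip_eq0; apply/eqP.
by rewrite eq_le x0 (ip_ge0 l2_ip_is_inner_product).
Qed.

HB.instance Definition _ :=
  Lmodule_isNormed.Build R l2 ler_l2_normD l2_normZ l2_norm_eq0.

Lemma l2_norm_sqrE (x : l2) : `|x| ^+ 2 = l2_ip x x.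
Proof. exact/sqr_sqrtr/(ip_ge0 l2_ip_is_inner_product). Qed.

Lemma l2_coord_le (x : l2) i : `|x i| <= `|x|.
Proof.
by rewrite -ler_sqr ?nnegrE// l2_norm_sqrE real_normK ?num_real// l2_coord_sqr_le.
Qed.

(** Coordinates are 1-Lipschitz, so they converge along [F]. Bounds on finite sums pass to the
    coordinatewise limit [l] uniformly in the number of terms, which gives both membership in [l2]
    and convergence in norm. *)
Lemma l2_complete (F : set_system l2) : ProperFilter F -> cauchy F -> cvg F.
Proof.
move=> FF /cauchyP Fc.
have coord_cvg i : cvg ((fun x : l2 => x i) @ F).
  apply: cauchy_cvg; apply: cauchy_exP => d /Fc[x Fx]; exists (x i).
  change (F ((fun y : l2 => y i) @^-1` ball (x i) d)).
  apply: filterS Fx => y; rewrite -!ball_normE /=; apply: le_lt_trans.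
  exact: l2_coord_le (x - y) i.
pose l i : R^o := lim ((fun x : l2 => x i) @ F).
have near_l d : 0 < d -> exists x : l2, F (ball x d) /\
    forall n, \sum_(0 <= i < n) (x i - l i) ^+ 2 <= d ^+ 2.
  move=> d0; have [x Fx] := Fc _ d0; exists x; split => // n.
  have : (fun y : l2 => \sum_(0 <= i < n) (x i - y i) ^+ 2) @ F -->
      \sum_(0 <= i < n) (x i - l i) ^+ 2.
    apply: cvg_big => [|i _]; first exact: add_continuous.
    apply: (@continuous_cvg _ _ _ F _ _ (fun t : R => t ^+ 2)).
      exact: exprn_continuous.
    by apply: cvgB; [exact: cvg_cst|exact: coord_cvg].
  move/cvgr_to_le; apply.
  apply: filterS Fx => y; rewrite -ball_normE /= => xy.
  apply: le_trans (l2_sum_sqr_le (x - y) n) _.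
  by rewrite -l2_norm_sqrE ler_sqr ?nnegrE// ltW.
(* Radius 1 suffices to show [x0 - l] square-summable; then [l = x0 - (x0 - l)] is too. *)
have [x0 [_ x0l]] := near_l _ ltr01.
have x0l_l2 : l2_fun x0 - l \in l2_pred.
  apply/l2_predP; apply: nondecreasing_is_cvgn.
    by apply: nondecreasing_series => i _ _; rewrite sqr_ge0.
  by exists (1 ^+ 2) => _ [n _ <-]; exact: x0l.
have l_l2 : l \in l2_pred by rewrite -(subKr (l2_fun x0) l) rpredB// l2_funP.
pose L := L2 l_l2; apply/cvg_ex; exists L.
move=> A /nbhs_ballP[d /= d0 dA].
have d20 : 0 < d / 2 by exact: divr_gt0.
have [x [Fx xl]] := near_l _ d20.
apply: filterS Fx => y xy; apply: dA.
rewrite -ball_normE /= -(subrKA x) (le_lt_trans (ler_normD _ _))//.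
rewrite [ltRHS]splitr ler_ltD//.
rewrite distrC -ler_sqr ?nnegrE ?(ltW d20)// l2_norm_sqrE.
exact: l2_ip_le (x - L) _ xl.
Qed.

HB.instance Definition _ := Uniform_isComplete.Build l2 l2_complete.

(** The partial sums are constant, equal to [u j], once they include the index [j]. *)
Lemma cvg_series_mul_delta u (j : nat) :
  series (fun i => u i * (i == j)%:R : R^o) @ \oo --> u j.
Proof.
apply: cvg_near_cst; near=> n; have jn : (j < n)%N by near: n; exists j.+1.
rewrite /series /= big_mkord (bigD1 (Ordinal jn))//= eqxx mulr1 big1 ?addr0//.
by move=> i ij; rewrite (negbTE (ij : (i != j :> nat))) mulr0.
Unshelve. all: by end_near. Qed.

Lemma l2_unit_mem (j : nat) : (fun i => (i == j)%:R : R^o) \in l2_pred.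
Proof.
apply/l2_predP/cvg_ex; exists 1.
(* A 0-1 value equals its square, so the series of squares is the delta series against the constant
   sequence 1. *)
rewrite [X in series X](_ : _ = fun i => 1 * (i == j)%:R).
  exact: (@cvg_series_mul_delta (fun=> 1)).
by apply/funext => i; case: eqP => _; rewrite ?mulr1 ?mulr0 ?expr1n ?expr0n.
Qed.

Definition l2_unit (j : nat) : l2 := L2 (l2_unit_mem j).

Lemma l2_ip_unit (x : l2) j : l2_ip x (l2_unit j) = x j.
Proof. by apply: cvg_lim => //; exact: cvg_series_mul_delta. Qed.

Lemma l2_unit_orthonormal i j : l2_ip (l2_unit i) (l2_unit j) = (i == j)%:R.
Proof. by rewrite l2_ip_unit /= eq_sym. Qed.

End L2.

(** * The counterexample on [l2] *)

Theorem proposition4p6 (R : realType) :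
  exists (E : completeNormedModType R) (C : set E) (A : nat -> E -> dual E),
    [/\ uniformly_smooth E /\ uniformly_convex E,
        [/\ C !=set0, closed C & convex_set (C : set (convex_lmodType E))],
        closed (duality_image C) /\
          convex_set (duality_image C : set (convex_lmodType (dual E))),
        forall j : nat, {within C, continuous (A j)} /\ monotone_on C (A j) &
        (exists p : E, \bigcap_j VI C (A j) = [set p]) /\
        forall N : nat, (1 <= N)%N ->
          infinite_dimensional (\bigcap_(j < N) VI C (A j))].
Proof.
pose ipP := @l2_ip_is_inner_product R; pose nE := @l2_norm_sqrE R.
exists (l2 : completeNormedModType R), setT.
exists (fun j => coordinate_map ipP nE (l2_unit j)); split.
- by split; [exact: ip_uniformly_smooth ipP nE|exact: ip_uniformly_convex ipP nE].
- split; [by exists 0|exact: closedT|].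
  by move=> x y t _ _; rewrite inE.
- rewrite (duality_imageE ipP nE); split; last exact: convex_range_riesz.
  by apply: closed_range_isometry => x; exact: norm_riesz.
- move=> j; split; last exact: coordinate_map_monotone.
  exact/continuous_subspaceT/coordinate_map_continuous.
- split.
    exists 0; apply/seteqP; split => [x xVI|_ -> j _].
      (* Membership in the [j]-th hyperplane says exactly that the [j]-th coordinate is zero. *)
      apply/val_inj/funext => j.
      have := xVI j I; rewrite VI_coordinate_map /= l2_ip_unit; exact.
    by rewrite VI_coordinate_map /= (ip0l ipP).
  move=> N _ [n [p [v Sv]]].
  (* The vectors orthogonal to the first [N] units all lie in the intersection, so an affine
     subspace containing it would contain them too. *)
  apply: (orthonormal_infinite_dimensional ipP (@l2_unit_orthonormal R) (N := N)).
  exists n, p, v; apply: subset_trans Sv => x xN j jN.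
  by rewrite VI_coordinate_map /=; exact: xN.
Qed.
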